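(* Let $\phi$ be an LTL formula in negation normal form. If the propositional formula $of(\phi)$ is satisfiable, then $\phi$ is satisfiable, i.e. there is an infinite word $\xi\in(2^{AP})^\omega$ with $\xi\models\phi$.
   Context: Let $AP$ be a finite set of atomic propositions. A literal is $a$ or $\neg a$ for $a\in AP$. NNF LTL formulas are generated by $\phi ::= \mathit{tt}\mid \mathit{ff}\mid a\mid \neg a\mid \phi\wedge\phi\mid\phi\vee\phi\mid X\phi\mid \phi U\phi\mid \phi R\phi$. The abbreviations $F\psi=\mathit{tt}U\psi$ and $G\psi=\mathit{ff}R\psi$ are used. Semantics: for $\xi=\xi(0)\xi(1)\cdots\in(2^{AP})^\omega$, let $\xi_k=\xi(k)\xi(k+1)\cdots$. Then: - $\xi\models a$ iff $a\in\xi(0)$, and $\xi\models\neg a$ iff $a\notin\xi(0)$; - $\xi\models\mathit{tt}$ always holds and $\xi\models\mathit{ff}$ never holds; - $\wedge$ and $\vee$ are interpreted as usual; - $\xi\models X\phi$ iff $\xi_1\models\phi$; - $\xi\models\phi_1U\phi_2$ iff there is $i\ge0$ with $\xi_i\models\phi_2$ and $\xi_j\models\phi_1$ for all $0\le j<i$; - $\xi\models\phi_1R\phi_2$ iff either $\xi_i\models\phi_2$ for all $i\ge0$, or there is $i\ge0$ with $\xi_i\models\phi_1\wedge\phi_2$ and $\xi_j\models\phi_2$ for all $0\le j<i$. The obligation formula $of(\phi)$ is defined recursively: - $of(\mathit{tt})=\mathit{tt}$, $of(\mathit{ff})=\mathit{ff}$; - $of(p)=p$ for a literal $p$; - $of(X\psi)=of(\psi)$;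 - $of(\phi_1U\phi_2)=of(\phi_1R\phi_2)=of(\phi_2)$; - $of(\phi_1\wedge\phi_2)=of(\phi_1)\wedge of(\phi_2)$; - $of(\phi_1\vee\phi_2)=of(\phi_1)\vee of(\phi_2)$. $of(\phi)$ is read as a propositional formula over $AP$. *)

(* Defs.v *)
From mathcomp Require Import all_boot.

Set Implicit Arguments.
Unset Strict Implicit.
Unset Printing Implicit Defensive.

Section Defs.
Variable AP : finType.

(* LTL formulas in negation normal form: negation occurs only in [LNAtom]. *)
Inductive ltl : Type :=
  | LTrue
  | LFalse
  | LAtom of AP
  | LNAtom of AP
  | LAnd of ltl & ltl
  | LOr of ltl & ltl
  | LNext of ltl
  | LUntil of ltl & ltl
  | LRelease of ltl & ltl.

Definition word : Type := nat -> {set AP}.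

Definition suffix_from (xi : word) (k : nat) : word := fun n => xi (k + n).

Fixpoint models (xi : word) (phi : ltl) {struct phi} : Prop :=
  match phi with
  | LTrue => True
  | LFalse => False
  | LAtom a => a \in xi 0
  | LNAtom a => a \notin xi 0
  | LAnd phi1 phi2 => models xi phi1 /\ models xi phi2
  | LOr phi1 phi2 => models xi phi1 \/ models xi phi2
  | LNext psi => models (suffix_from xi 1) psi
  | LUntil phi1 phi2 =>
      exists i : nat, models (suffix_from xi i) phi2 /\
        forall j : nat, j < i -> models (suffix_from xi j) phi1
  | LRelease phi1 phi2 =>
      (forall i : nat, models (suffix_from xi i) phi2) \/
      (exists i : nat,
         (models (suffix_from xi i) phi1 /\ models (suffix_from xi i) phi2) /\
         forall j : nat, j < i -> models (suffix_from xi j) phi2)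
  end.

Inductive pform : Type :=
  | PTrue
  | PFalse
  | PAtom of AP
  | PNAtom of AP
  | PAnd of pform & pform
  | POr of pform & pform.

(* A valuation is given by the set of atoms it makes true. *)
Fixpoint peval (v : {set AP}) (p : pform) : bool :=
  match p with
  | PTrue => true
  | PFalse => false
  | PAtom a => a \in v
  | PNAtom a => a \notin v
  | PAnd p1 p2 => peval v p1 && peval v p2
  | POr p1 p2 => peval v p1 || peval v p2
  end.

Definition prop_satisfiable (p : pform) : Prop :=
  exists v : {set AP}, peval v p.

Fixpoint obligation (phi : ltl) : pform :=
  match phi with
  | LTrue => PTrue
  | LFalse => PFalse
  | LAtom a => PAtom a
  | LNAtom a => PNAtom a
  | LAnd phi1 phi2 => PAnd (obligation phi1) (obligation phi2)
  | LOr phi1 phi2 => POr (obligation phi1) (obligation phi2)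
  | LNext psi => obligation psi
  | LUntil _ phi2 => obligation phi2
  | LRelease _ phi2 => obligation phi2
  end.

End Defs.

(* Main.v *)
Require Import Defs.
From mathcomp Require Import all_boot.

(* Every suffix of a constant word is, by conversion, the word itself; hence U
   can be fulfilled at position 0 and R by its second argument holding forever,
   which is exactly what the obligation formula asks for. *)
Lemma models_const (AP : finType) (v : {set AP}) (phi : ltl AP) :
  peval v (obligation phi) -> models (fun=> v) phi.
Proof.
(* [//=] also closes the [LNext] case: the suffix of [fun=> v] from 1 is convertible to [fun=> v],
   so the induction hypothesis is already the goal. The cases left are conjunction, disjunction, U
   and R. *)
elim: phi => //= [p IHp q IHq|p IHp q IHq|p _ q IHq|p _ q IHq].
- by case/andP=> /IHp ? /IHq.
- by case/orP=> [/IHp|/IHq]; [left | right].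
(* At witness 0 the condition on earlier positions [j < 0] is vacuous, so only the second argument
   has to hold. *)
- by move=> /IHq ?; exists 0.
- by move=> /IHq ?; left.
Qed.

Theorem theorem4 (AP : finType) (phi : ltl AP) :
  prop_satisfiable (obligation phi) ->
  exists xi : word AP, models xi phi.
Proof. by case=> v /models_const ?; exists (fun=> v). Qed.
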